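(* Let $\ell^{OI}$ be a line in a Desargues affine plane, with its skew field structure $(\ell^{OI},+,\cdot)$ given by addition and multiplication of points, and let $A,B,C\in\ell^{OI}$ be fixed. Let $\mathcal{R}^{D}_4=\{f_D(X)=c_r(A,B;C,X)\mid X\in\ell^{OI}\}$, where $c_r(A,B;C,X)=[(A-X)^{-1}(B-X)][(B-C)^{-1}(A-C)]$. Then for any three elements $f_D(X),f_D(Y),f_D(Z)$ of $\mathcal{R}^{D}_4$: (1) $f_D(X)\cdot[f_D(Y)+f_D(Z)]=f_D(X)\cdot f_D(Y)+f_D(X)\cdot f_D(Z)$; and (2) $[f_D(X)+f_D(Y)]\cdot f_D(Z)=f_D(X)\cdot f_D(Z)+f_D(Y)\cdot f_D(Z)$.
   Context: A Desargues affine plane is an affine plane (two distinct points lie on exactly one line; through a point $P$ not on a line $\ell$ passes exactly one line disjoint from $\ell$; there are three non-collinear points) satisfying Desargues' axiom: if $\ell^{AA'},\ell^{BB'},\ell^{CC'},\ell^{AC},\ell^{A'C'}$ are pairwise distinct lines such that $\ell^{AA'},\ell^{BB'},\ell^{CC'}$ are all parallel or all meet in one point $P$, and if $\ell^{AB}\parallel\ell^{A'B'}$, $\ell^{BC}\parallel\ell^{B'C'}$, $A\ne C$, $A'\ne C'$, $\ell^{AB}\ne\ell^{A'B'}$, $\ell^{BC}\ne\ell^{B'C'}$, then $\ell^{AC}\parallel\ell^{A'C'}$. Here $\ell^{PQ}$ is the line through $P,Q$, and $\ell^{R}_{PQ}$ is the line through $R$ parallel to $\ell^{PQ}$. Fix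 a line $\ell^{OI}$ through two distinct points $O,I$. For $A,B\in\ell^{OI}$ and an auxiliary point $B_1\notin\ell^{OI}$: addition: $P_1=\ell^{B_1}_{OI}\cap\ell^{A}_{OB_1}$ and $A+B=\ell^{P_1}_{BB_1}\cap\ell^{OI}$; multiplication: $P_1=\ell^{A}_{IB_1}\cap\ell^{OB_1}$ and $A\cdot B=\ell^{P_1}_{BB_1}\cap\ell^{OI}$. It is known that $(\ell^{OI},+,\cdot)$ is a skew field (division ring) with zero $O$ and unit $I$. Cross-ratio: for four points $A,B,C,D\in\ell^{OI}$, no three of them equal, $c_r(A,B;C,D)=[(A-D)^{-1}(B-D)][(B-C)^{-1}(A-C)]$, computed in this skew field. The paper writes the cross-ratio for all $X\in\ell^{OI}$ and gives no separate convention for a value of $X$ at which an inverse of $O$ would occur. The subscript $D$ in $f_D$ and superscript $D$ in $\mathcal{R}^{D}_4$ only indicate which of the four positions is variable. *)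

(* Defs.v *)
From Stdlib Require Import List ClassicalEpsilon.
Import ListNotations.
Set Implicit Arguments.
Unset Strict Implicit.

Record AffinePlane : Type := {
  point : Type;
  line : Type;
  on : point -> line -> Prop;
  join_ex : forall P Q : point, P <> Q -> exists! l : line, on P l /\ on Q l;
  par_ex : forall (P : point) (l : line), ~ on P l ->
    exists! m : line, on P m /\ ~ (exists Q : point, on Q m /\ on Q l);
  (* Pairwise distinctness is needed: it excludes the plane with one point and
     no line. *)
  triangle_ex : exists P Q R : point, P <> Q /\ Q <> R /\ P <> R /\
    ~ (exists l : line, on P l /\ on Q l /\ on R l)
}.

Lemma line_inhabited (pi : AffinePlane) : inhabited (line pi).
Proof.
destruct (triangle_ex pi) as [P [Q [_ [PQ _]]]].
destruct (join_ex PQ) as [l _]; exact (inhabits l).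
Qed.

Section Lines.
Variable pi : AffinePlane.

(* A line is parallel to itself. *)
Definition parallel (l m : line pi) : Prop :=
  l = m \/ ~ (exists Q : point pi, on Q l /\ on Q m).

(* The line l^{PQ}; its value is meaningful only for P <> Q. *)
Definition join (P Q : point pi) : line pi :=
  epsilon (line_inhabited pi) (fun l => on P l /\ on Q l).

(* The line through R parallel to l; it is l itself when R lies on l. *)
Definition par (R : point pi) (l : line pi) : line pi :=
  epsilon (line_inhabited pi) (fun m => on R m /\ parallel m l).

(* The inequalities of points say that every l^{PQ} occurring in the axiom is
   the line through two distinct points. *)
Definition desargues : Prop :=
  forall A B C A' B' C' : point pi,
    A <> A' -> B <> B' -> C <> C' ->
    A <> B -> A' <> B' -> B <> C -> B' <> C' -> A <> C -> A' <> C' ->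
    NoDup [join A A'; join B B'; join C C'; join A C; join A' C'] ->
    (parallel (join A A') (join B B') /\ parallel (join B B') (join C C') /\
       parallel (join A A') (join C C')) \/
    (exists P : point pi,
       on P (join A A') /\ on P (join B B') /\ on P (join C C')) ->
    parallel (join A B) (join A' B') -> parallel (join B C) (join B' C') ->
    join A B <> join A' B' -> join B C <> join B' C' ->
    parallel (join A C) (join A' C').

End Lines.

Record DesarguesPlane : Type := {
  plane :> AffinePlane;
  desargues_axiom : desargues plane
}.

Section Coordinates.
Variables (pi : DesarguesPlane) (O I : point pi).

Definition is_sum (A B S : point pi) : Prop :=
  exists B1 P1 : point pi,
    ~ on B1 (join O I) /\
    on P1 (par B1 (join O I)) /\ on P1 (par A (join O B1)) /\
    on S (par P1 (join B B1)) /\ on S (join O I).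

Definition is_product (A B S : point pi) : Prop :=
  exists B1 P1 : point pi,
    ~ on B1 (join O I) /\
    on P1 (par A (join I B1)) /\ on P1 (join O B1) /\
    on S (par P1 (join B B1)) /\ on S (join O I).

(* For O <> I and A, B on l^{OI} the sum and the product exist and do not depend
   on the auxiliary point B1, so the point selected here is the only one. *)
Definition add (A B : point pi) : point pi := epsilon (inhabits O) (is_sum A B).
Definition mul (A B : point pi) : point pi :=
  epsilon (inhabits O) (is_product A B).

Definition opp (A : point pi) : point pi :=
  epsilon (inhabits O)
    (fun S => on S (join O I) /\ add A S = O /\ add S A = O).

Definition sub (A B : point pi) : point pi := add A (opp B).

(* The inverse of O is some unspecified point of l^{OI}. *)
Definition inv (A : point pi) : point pi :=
  epsilon (inhabits O)
    (fun S => on S (join O I) /\ (A <> O -> mul A S = I /\ mul S A = I)).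

(* Total: no condition that no three of the points are equal is imposed, and
   opp and inv only take values on l^{OI}, so the result is always on l^{OI}. *)
Definition cross_ratio (A B C D : point pi) : point pi :=
  mul (mul (inv (sub A D)) (sub B D)) (mul (inv (sub B C)) (sub A C)).

Definition f_D (A B C X : point pi) : point pi := cross_ratio A B C X.

Definition R4_D (A B C : point pi) : point pi -> Prop :=
  fun U => exists X : point pi, on X (join O I) /\ U = f_D A B C X.

End Coordinates.

(* Main.v *)
From Stdlib Require Import List Classical ClassicalEpsilon.
Require Import Defs.
Import ListNotations.
Set Implicit Arguments.
Unset Strict Implicit.

(* Call a map of points a dilation when it sends every line into a parallel one;
   it is determined by its values at two points.  Desargues' axiom produces all
   translations and all homotheties.  The constructions of sum and product say
   that A + B is the image of B under the translation taking O to A, and A . B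
   its image under the homothety fixing O and taking I to A.  Left distributivity
   holds because a homothety carries a translation to a translation.  For right
   distributivity, the pointwise sum of the homotheties of A and B is again a
   dilation, and it agrees with that of A + B at O and I. *)

(** * Incidence and parallelism in an affine plane *)

Section Affine.
Variable pi : AffinePlane.
Implicit Types (P Q R X Y Z : point pi) (l m n d e : line pi).

Lemma join_spec P Q : P <> Q -> on P (join P Q) /\ on Q (join P Q).
Proof.
intros PQ; unfold join; apply epsilon_spec.
destruct (join_ex PQ) as [l [Hl _]]; exists l; exact Hl.
Qed.

Lemma join_l P Q : P <> Q -> on P (join P Q).
Proof. intros PQ; apply (join_spec PQ). Qed.

Lemma join_r P Q : P <> Q -> on Q (join P Q).
Proof. intros PQ; apply (join_spec PQ). Qed.

Lemma line_eq P Q l m : P <> Q -> on P l -> on Q l -> on P m -> on Q m -> l = m.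
Proof.
intros PQ Pl Ql Pm Qm; destruct (join_ex PQ) as [k [_ Hk]].
rewrite <- (Hk l), <- (Hk m); auto.
Qed.

Lemma join_eq P Q l : P <> Q -> on P l -> on Q l -> join P Q = l.
Proof.
intros PQ Pl Ql; apply (@line_eq P Q); auto using join_l, join_r.
Qed.

Lemma meet_eq P Q l m : l <> m -> on P l -> on Q l -> on P m -> on Q m -> P = Q.
Proof.
intros lm Pl Ql Pm Qm; apply NNPP; intros PQ; apply lm; apply (@line_eq P Q); auto.
Qed.

Lemma parallel_refl l : parallel l l.
Proof. left; reflexivity. Qed.

Lemma parallel_sym l m : parallel l m -> parallel m l.
Proof.
intros [-> | H]; [left; reflexivity | right].
intros [Q [Ql Qm]]; apply H; exists Q; auto.
Qed.

Lemma parallel_eq P l m : parallel l m -> on P l -> on P m -> l = m.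
Proof. intros [E | H] Pl Pm; [exact E | case H; exists P; auto]. Qed.

Lemma par_unique P l m n :
  on P m -> parallel m l -> on P n -> parallel n l -> m = n.
Proof.
intros Pm ml Pn nl; destruct (classic (on P l)) as [Pl | Pl].
  now rewrite (parallel_eq ml Pm Pl), (parallel_eq nl Pn Pl).
destruct (par_ex Pl) as [k [_ Hk]].
destruct ml as [-> | ml]; [contradiction |].
destruct nl as [-> | nl]; [contradiction |].
rewrite <- (Hk m), <- (Hk n); auto.
Qed.

Lemma par_spec P l : on P (par P l) /\ parallel (par P l) l.
Proof.
unfold par; apply epsilon_spec; destruct (classic (on P l)) as [Pl | Pl].
  exists l; auto using parallel_refl.
destruct (par_ex Pl) as [k [[Pk kl] _]]; exists k; split; [exact Pk | right; exact kl].
Qed.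

Lemma par_on P l : on P (par P l).
Proof. apply par_spec. Qed.

Lemma par_parallel P l : parallel (par P l) l.
Proof. apply par_spec. Qed.

Lemma par_eq P l m : on P m -> parallel m l -> par P l = m.
Proof.
intros Pm ml; apply (@par_unique P l); auto using par_on, par_parallel.
Qed.

Lemma parallel_trans l m n : parallel l m -> parallel m n -> parallel l n.
Proof.
intros lm mn; destruct (classic (exists Q, on Q l /\ on Q n)) as [[Q [Ql Qn]] | H].
  left; apply (@par_unique Q m); auto using parallel_sym.
right; exact H.
Qed.

Lemma par_congr P l m : parallel l m -> par P l = par P m.
Proof.
intros lm; apply par_eq; [apply par_on |].
apply parallel_trans with m; auto using par_parallel, parallel_sym.
Qed.

Lemma par_same P l : on P l -> par P l = l.
Proof. intros Pl; apply par_eq; auto using parallel_refl. Qed.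

Lemma par_move P Q l : on Q (par P l) -> par Q l = par P l.
Proof. intros H; apply par_eq; auto using par_parallel. Qed.

Lemma par_par P Q l : par P (par Q l) = par P l.
Proof. apply par_congr, par_parallel. Qed.

Lemma par_sym P Q l : on Q (par P l) -> on P (par Q l).
Proof. intros H; rewrite (par_move H); apply par_on. Qed.

Lemma par_trans P Q R l : on Q (par P l) -> on R (par Q l) -> on R (par P l).
Proof. intros H; rewrite (par_move H); auto. Qed.

Lemma not_parallel_meet l m : ~ parallel l m -> exists P, on P l /\ on P m.
Proof. intros H; apply NNPP; intros K; apply H; right; exact K. Qed.

Lemma point_off l : exists P, ~ on P l.
Proof.
destruct (triangle_ex pi) as [P [Q [R [_ [_ [_ H]]]]]].
apply NNPP; intros K; apply H; exists l.
repeat split; apply NNPP; intros N; apply K; eexists; exact N.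
Qed.

(** * Dilations and translations *)

Definition dilation (h : point pi -> point pi) : Prop :=
  forall X Y l, on X l -> on Y l -> on (h Y) (par (h X) l).

Definition along d (h : point pi -> point pi) : Prop :=
  forall X, on (h X) (par X d).

(** Fixed points are allowed, so the identity counts; by [translation_fix] it is the only
    translation that has one. *)
Definition translation (h : point pi -> point pi) : Prop :=
  dilation h /\ exists d, along d h.

Lemma dilation_id : dilation (fun X => X).
Proof. intros X Y l Xl Yl; now rewrite par_same. Qed.

(** This degenerate dilation, with [P] the origin, serves as multiplication by [O]. *)
Lemma dilation_const P : dilation (fun _ => P).
Proof. intros X Y l _ _; apply par_on. Qed.

Lemma dilation_comp f g : dilation f -> dilation g -> dilation (fun X => f (g X)).
Proof.
intros Hf Hg X Y l Xl Yl; rewrite <- (par_par _ (g X)).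
apply Hf; [apply par_on | apply Hg; auto].
Qed.

Lemma along_id d : along d (fun X => X).
Proof. intros X; apply par_on. Qed.

Lemma along_comp d f g : along d f -> along d g -> along d (fun X => f (g X)).
Proof. intros Hf Hg X; exact (par_trans (Hg X) (Hf (g X))). Qed.

Lemma along_parallel d e f : parallel d e -> along d f -> along e f.
Proof. intros de Hf X; rewrite <- (par_congr X de); apply Hf. Qed.

(** The image of [X] is the meet of the parallels to [PX] and [QX] through the images of [P] and
    [Q]; these differ because [X] is off [PQ]. *)
Lemma dilation_ext_off f g P Q X :
  dilation f -> dilation g -> P <> Q -> f P = g P -> f Q = g Q ->
  ~ on X (join P Q) -> f X = g X.
Proof.
intros Hf Hg PQ EP EQ HX.
assert (PX : P <> X) by (intros <-; auto using join_l).
assert (QX : Q <> X) by (intros <-; auto using join_r).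
apply (@meet_eq _ _ (par (f P) (join P X)) (par (f Q) (join Q X))).
- intros E; assert (K : parallel (join P X) (join Q X)).
    apply parallel_trans with (par (f P) (join P X));
      [apply parallel_sym, par_parallel | rewrite E; apply par_parallel].
  apply HX; rewrite (@join_eq P Q (join P X)); auto using join_l, join_r.
  rewrite (parallel_eq K (join_r PX) (join_r QX)); auto using join_l.
- apply Hf; auto using join_l, join_r.
- rewrite EP; apply Hg; auto using join_l, join_r.
- apply Hf; auto using join_l, join_r.
- rewrite EQ; apply Hg; auto using join_l, join_r.
Qed.

Lemma dilation_ext f g P Q :
  dilation f -> dilation g -> P <> Q -> f P = g P -> f Q = g Q ->
  forall X, f X = g X.
Proof.
intros Hf Hg PQ EP EQ X; destruct (classic (on X (join P Q))) as [HX | HX].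
2: exact (dilation_ext_off Hf Hg PQ EP EQ HX).
destruct (classic (P = X)) as [<- | PX]; [exact EP |].
(* A point [Y] off [PQ] replaces [Q]: then [X] is off [PY]. *)
destruct (point_off (join P Q)) as [Y HY].
assert (EY := dilation_ext_off Hf Hg PQ EP EQ HY).
assert (PY : P <> Y) by (intros <-; auto using join_l).
apply (dilation_ext_off Hf Hg PY EP EY).
intros K; apply HY.
rewrite (@line_eq P X (join P Q) (join P Y)); auto using join_l, join_r.
Qed.

(** For [X] off the [d]-line of [Q], both images lie on the parallel to [QX] through [f Q] and on
    the [d]-line of [f X], so they coincide. Points on the [d]-line of [P] are reached through a [Y]
    off it. *)
Lemma dilation_ext_along f g d P :
  dilation f -> dilation g -> f P = g P -> (forall X, on (g X) (par (f X) d)) ->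
  forall X, f X = g X.
Proof.
intros Hf Hg EP Hd.
assert (off : forall Q X, f Q = g Q -> ~ on X (par Q d) -> f X = g X).
{ intros Q X EQ HX.
  assert (QX : Q <> X) by (intros <-; auto using par_on).
  apply (@meet_eq _ _ (par (f Q) (join Q X)) (par (f X) d)); auto using par_on.
  - intros E; apply HX; rewrite (@par_eq Q d (join Q X)); auto using join_l, join_r.
    apply parallel_trans with (par (f Q) (join Q X));
      [apply parallel_sym, par_parallel | rewrite E; apply par_parallel].
  - apply Hf; auto using join_l, join_r.
  - rewrite EQ; apply Hg; auto using join_l, join_r. }
intros X; destruct (classic (on X (par P d))) as [HX | HX]; [| exact (off P X EP HX)].
destruct (point_off (par P d)) as [Y HY].
apply (off Y X (off P Y EP HY)); intros K; apply HY.
exact (par_trans HX (par_sym K)).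
Qed.

Lemma translation_id : translation (fun X => X).
Proof.
split; [exact dilation_id |].
destruct (line_inhabited pi) as [d]; exists d; apply along_id.
Qed.

Lemma translation_fix f P : translation f -> f P = P -> forall X, f X = X.
Proof.
intros [Hf [d Hd]] E.
apply (dilation_ext_along Hf dilation_id E (d := d)).
intros X; apply par_sym, Hd.
Qed.

(** If [f] moves [P], the line through [P] and [f P] is the direction of both maps; otherwise both
    are the identity. *)
Lemma translation_ext f g P :
  translation f -> translation g -> f P = g P -> forall X, f X = g X.
Proof.
intros Tf Tg E X; destruct (classic (f P = P)) as [F | F].
  rewrite (translation_fix Tf F); rewrite E in F.
  now rewrite (translation_fix Tg F).
destruct Tf as [Hf [d Hd]], Tg as [Hg [e He]]; revert X.
apply (dilation_ext_along Hf Hg E (d := d)).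
assert (de : par P d = par P e).
{ apply (@line_eq P (f P)); auto using par_on; rewrite E; apply He. }
intros X; apply par_trans with X; [apply par_sym, Hd |].
rewrite <- (par_par X P), de, par_par; apply He.
Qed.

(** Each line through [X] and [f X] is mapped into itself, so a common point of two such lines would
    be fixed. Hence they are all parallel. *)
Lemma free_dilation_translation f :
  dilation f -> (forall X, f X <> X) -> translation f.
Proof.
intros Hf F; split; [exact Hf |].
assert (inv_line : forall X Y, on Y (join X (f X)) -> on (f Y) (join X (f X))).
{ intros X Y H; assert (XF : X <> f X) by (intros E; exact (F X (eq_sym E))).
  rewrite <- (par_same (join_r XF)); apply Hf; auto using join_l. }
destruct (triangle_ex pi) as [P _].
exists (join P (f P)); intros X.
assert (PF : P <> f P) by (intros E; exact (F P (eq_sym E))).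
assert (XF : X <> f X) by (intros E; exact (F X (eq_sym E))).
rewrite (@par_eq X (join P (f P)) (join X (f X))); auto using join_l, join_r.
apply NNPP; intros N; destruct (not_parallel_meet N) as [R [R1 R2]].
apply (F R); apply (@meet_eq _ _ (join X (f X)) (join P (f P))); auto.
intros E; apply N; rewrite E; apply parallel_refl.
Qed.

Lemma translation_comp f g :
  translation f -> translation g -> translation (fun X => f (g X)).
Proof.
intros Tf Tg; assert (Hfg := dilation_comp (proj1 Tf) (proj1 Tg)).
destruct (classic (exists R, f (g R) = R)) as [[R E] | N].
2: { apply free_dilation_translation; [exact Hfg |].
     intros X EX; apply N; exists X; exact EX. }
destruct Tf as [Hf [d Hd]], Tg as [Hg [e He]]; split; [exact Hfg |].
destruct (classic (parallel d e)) as [de | de].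
  exists e; exact (along_comp (along_parallel de Hd) He).
(* [g R] lies on the lines through [R] in both directions, which meet only in [R]; so [g] is the
   identity. *)
assert (gR : g R = R).
{ apply (@meet_eq _ _ (par R e) (par R d)); auto using par_on.
  - intros K; apply de; apply parallel_trans with (par R d);
      [apply parallel_sym | rewrite <- K]; apply par_parallel.
  - apply par_sym; rewrite <- E at 1; apply Hd. }
assert (gid := translation_fix (conj Hg (ex_intro _ e He)) gR).
exists d; intros X; rewrite gid; apply Hd.
Qed.

End Affine.

(** * Perspectivities along a pencil of lines *)

(* [t] assigns to each good point its line in a pencil.  For a parallel class
   every point is good; for the lines through a centre only the centre is bad. *)
Section Pencil.
Variables (pi : DesarguesPlane) (good : point pi -> Prop) (t : point pi -> line pi).
Implicit Types (X Y Z W : point pi).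
Hypothesis t_on : forall X, good X -> on X (t X).
Hypothesis t_eq : forall X Y, good X -> good Y -> on Y (t X) -> t Y = t X.
Hypothesis bad_on : forall X Y, ~ good X -> good Y -> on X (t Y).
Hypothesis t_pencil :
  (forall X Y, good X -> good Y -> parallel (t X) (t Y)) \/
  (exists P, forall X, good X -> on P (t X)).

Record move (X X' : point pi) : Prop := {
  move_src : good X; move_tgt : good X'; move_on : on X' (t X); move_ne : X <> X' }.

(** Points on one pencil line are excluded: there both joins are that line, and the parallelism
    would say nothing. *)
Definition linked X X' Y Y' : Prop :=
  t X <> t Y /\ parallel (join X Y) (join X' Y').

Lemma move_t X X' : move X X' -> t X' = t X.
Proof. intros [g g' o _]; auto. Qed.

Lemma move_on_src X X' : move X X' -> on X (t X).
Proof. intros m; exact (t_on (move_src m)). Qed.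

Lemma move_join X X' : move X X' -> join X X' = t X.
Proof. intros m; apply join_eq; [apply m | exact (move_on_src m) | apply m]. Qed.

Lemma t_ne X Y : t X <> t Y -> X <> Y.
Proof. intros H <-; auto. Qed.

Lemma join_ne_t X Y Z : good X -> good Y -> good Z -> t X <> t Y -> join X Y <> t Z.
Proof.
intros gX gY gZ XY E; apply XY.
assert (N := t_ne XY).
rewrite (@t_eq Z X), (@t_eq Z Y); auto; rewrite <- E; auto using join_l, join_r.
Qed.

Lemma move_tgt_ne X X' Y Y' : move X X' -> move Y Y' -> t X <> t Y -> X' <> Y'.
Proof.
intros mX mY N; apply t_ne; now rewrite (move_t mX), (move_t mY).
Qed.

Lemma move_lines_ne X X' Y Y' :
  move X X' -> move Y Y' -> t X <> t Y -> join X Y <> join X' Y'.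
Proof.
intros mX mY N E; apply (@join_ne_t X Y X); auto; try apply mX; try apply mY.
rewrite <- (move_join mX); symmetry; apply join_eq; [apply mX | |].
  now apply join_l, t_ne.
rewrite E; apply join_l; exact (move_tgt_ne mX mY N).
Qed.

Lemma join_sym X Y : X <> Y -> join X Y = join Y X.
Proof. intros N; apply join_eq; auto using join_l, join_r. Qed.

Lemma linked_sym X X' Y Y' :
  move X X' -> move Y Y' -> linked X X' Y Y' -> linked Y Y' X X'.
Proof.
intros mX mY [N H]; split; [auto |].
rewrite (@join_sym Y X), (@join_sym Y' X'); auto.
- intros E; exact (move_tgt_ne mX mY N (eq_sym E)).
- intros E; apply N; now rewrite E.
Qed.

(** This is Desargues' axiom for the two triangles, in perspective along the pencil. *)
Lemma linked_trans X X' Y Y' Z Z' :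
  move X X' -> move Y Y' -> move Z Z' -> t X <> t Z ->
  linked X X' Y Y' -> linked Y Y' Z Z' -> linked X X' Z Z'.
Proof.
intros mX mY mZ XZ [XY pXY] [YZ pYZ]; split; [exact XZ |].
assert (gX := move_src mX); assert (gY := move_src mY); assert (gZ := move_src mZ).
assert (gX' := move_tgt mX); assert (gZ' := move_tgt mZ).
apply (@desargues_axiom pi X Y Z X' Y' Z'); eauto using move_ne, t_ne, move_tgt_ne, move_lines_ne.
- assert (XZ' : t X' <> t Z') by now rewrite (move_t mX), (move_t mZ).
  rewrite (move_join mX), (move_join mY), (move_join mZ).
  (* For [NoDup]: a transversal is never a pencil line ([J], [J']), and the two transversals differ
     from each other ([K]). *)
  assert (J := fun W gW => @join_ne_t X Z W gX gZ gW XZ).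
  assert (J' := fun W gW => @join_ne_t X' Z' W gX' gZ' gW XZ').
  assert (K := move_lines_ne mX mZ XZ).
  repeat constructor; simpl; intuition (eauto using eq_sym).
  all: try (eapply J; [| symmetry; eassumption]; assumption).
  all: eapply J'; [| symmetry; eassumption]; assumption.
- rewrite (move_join mX), (move_join mY), (move_join mZ).
  destruct t_pencil as [H | [P H]]; [left; auto | right; exists P; auto].
Qed.

Lemma linked_target_unique X X1 X2 Y Y' :
  move X X1 -> move X X2 -> move Y Y' ->
  linked X X1 Y Y' -> linked X X2 Y Y' -> X1 = X2.
Proof.
intros m1 m2 mY [N p1] [_ p2].
assert (g' := move_tgt mY).
assert (N1 := move_tgt_ne m1 mY N); assert (N2 := move_tgt_ne m2 mY N).
apply (@meet_eq _ _ _ (t X) (join X1 Y')); try apply m1; try apply m2; auto using join_l.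
- intros E; apply (@join_ne_t X1 Y' X); auto; try apply m1.
  now rewrite (move_t m1), (move_t mY).
- rewrite (@parallel_eq _ Y' (join X1 Y') (join X2 Y')); auto using join_l, join_r.
  apply parallel_trans with (join X Y); [apply parallel_sym |]; auto.
Qed.

(** The target is the meet of [t X] with the parallel to [XY] through [Y']. *)
Lemma linked_target_exists X Y Y' :
  move Y Y' -> good X -> t X <> t Y -> exists X', move X X' /\ linked X X' Y Y'.
Proof.
intros mY gX N.
assert (gY := move_src mY); assert (gY' := move_tgt mY).
assert (XY := t_ne N).
assert (Np : ~ parallel (t X) (par Y' (join X Y))).
{ intros H; apply (@join_ne_t X Y X); auto.
  symmetry; apply (@parallel_eq _ X); auto using join_l.
  apply parallel_trans with (1 := H), par_parallel. }
destruct (not_parallel_meet Np) as [X' [X1 X2]].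
assert (E : X' <> Y' -> join X' Y' = par Y' (join X Y)).
{ intros H; apply join_eq; auto using par_on. }
assert (NY : par Y' (join X Y) <> t Y).
{ intros H; apply (@join_ne_t X Y Y); auto.
  apply (@parallel_eq _ Y); auto using join_r.
  rewrite <- H; apply parallel_sym, par_parallel. }
(* A bad point lies on every pencil line; with [Y'] it would make the parallel equal to [t Y]. *)
assert (gX' : good X').
{ apply NNPP; intros b; apply NY.
  apply (@line_eq _ X' Y'); auto using par_on; [intros F; now rewrite F in b |].
  apply mY. }
assert (mX : move X X').
{ split; auto; intros F; subst X'.
  apply (@join_ne_t X Y Y); auto.
  apply (@line_eq _ Y Y'); auto using join_r; try apply mY.
  rewrite (@parallel_eq _ X (join X Y) (par Y' (join X Y))); auto using join_l, par_on.
  apply parallel_sym, par_parallel. }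
exists X'; split; [exact mX | split; [exact N |]].
rewrite E; [apply parallel_sym, par_parallel |].
exact (move_tgt_ne mX mY N).
Qed.

(* A plane covered by two lines of the pencil has only two points on each line
   crossing them, so disjointness of [join X Y] and [join X' Y'] is automatic. *)
Lemma third_or_linked X Y :
  good X -> good Y -> t X <> t Y ->
  (exists Z, good Z /\ t Z <> t X /\ t Z <> t Y) \/
  (forall X' Y', move X X' -> move Y Y' -> linked X X' Y Y').
Proof.
intros gX gY N.
destruct (classic (exists Z, good Z /\ t Z <> t X /\ t Z <> t Y)) as [H | H];
  [left; exact H | right].
assert (cover : forall Z, on Z (t X) \/ on Z (t Y)).
{ intros Z; destruct (classic (good Z)) as [gZ | bZ]; [| left; auto].
  apply NNPP; intros K; apply H; exists Z; repeat split; auto;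
    intros E; apply K; [left | right]; rewrite <- E; auto. }
intros X' Y' mX mY; split; [exact N |].
assert (N' := move_tgt_ne mX mY N); assert (XY := t_ne N).
assert (tN' : t X' <> t Y') by now rewrite (move_t mX), (move_t mY).
assert (gX' := move_tgt mX); assert (gY' := move_tgt mY).
right; intros [Q [Q1 Q2]]; destruct (cover Q) as [K | K].
- apply (move_ne mX).
  rewrite (@meet_eq _ X Q (join X Y) (t X)); auto using join_l, join_ne_t.
  apply (@meet_eq _ _ _ (join X' Y') (t X)); auto using join_l, join_ne_t; apply mX.
- apply (move_ne mY).
  rewrite (@meet_eq _ Y Q (join X Y) (t Y)); auto using join_r, join_ne_t.
  apply (@meet_eq _ _ _ (join X' Y') (t Y)); auto using join_r, join_ne_t; apply mY.
Qed.

Section Base.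
Variables I A : point pi.
Hypothesis base : move I A.

(* The last clause quantifies over all W so that images defined through different
   auxiliary points are consistent, including for X on [t I], where the base move
   itself cannot be used. *)
Definition image_spec X X' : Prop :=
  move X X' /\ (t X <> t I -> linked X X' I A) /\
  forall W W', move W W' -> t W <> t I -> linked W W' I A ->
    t W <> t X -> linked X X' W W'.

(** The base move fixes the image, and consistency with [W] follows by Desargues through [I]. *)
Lemma image_exists_off X : good X -> t X <> t I -> exists X', image_spec X X'.
Proof.
intros gX N; destruct (linked_target_exists base gX N) as [X' [mX L]].
exists X'; split; [exact mX | split; [auto |]].
intros W W' mW WI LW WX.
apply (linked_trans mX base mW); auto using linked_sym.
Qed.

Lemma good_off_base : exists Z, good Z /\ t Z <> t I.
Proof.
destruct (point_off (t I)) as [Z HZ].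
assert (gZ : good Z) by (apply NNPP; intros b; apply HZ, bad_on; auto; apply base).
exists Z; split; [exact gZ |]; intros F; apply HZ; rewrite <- F; auto.
Qed.

(** For [X] on the base line the image is defined through an auxiliary [Z]. A [W] off the line of
    [Z] is linked through [Z]; for [W] on it, a third line carrying some [K] is used. *)
Lemma image_exists X : good X -> exists X', image_spec X X'.
Proof.
intros gX; destruct (classic (t X = t I)) as [E | N]; [| exact (image_exists_off gX N)].
destruct good_off_base as [Z [gZ ZI]].
destruct (image_exists_off gZ ZI) as [Z' [mZ [LZ _]]]; specialize (LZ ZI).
assert (XZ : t X <> t Z) by (rewrite E; auto).
destruct (linked_target_exists mZ gX XZ) as [X' [mX LX]].
exists X'; split; [exact mX | split; [contradiction |]]; intros W W' mW WI LW WX.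
assert (via : forall K K', move K K' -> t K <> t I -> linked K K' I A ->
  linked X X' K K' -> t W <> t K -> linked X X' W W').
{ intros K K' mK KI LK LXK WK.
  apply (linked_trans mX mK mW); auto.
  apply (linked_trans mK base mW); auto using linked_sym. }
destruct (classic (t W = t Z)) as [WZ | WZ]; [| exact (via Z Z' mZ ZI LZ LX WZ)].
(* Without a third pencil line the required link holds outright. *)
destruct (third_or_linked gX (move_src mW) (not_eq_sym WX)) as [[K [gK [KX KW]]] | H]; auto.
rewrite E in KX; destruct (linked_target_exists base gK KX) as [K' [mK LK]].
assert (ZK : t Z <> t K) by (rewrite <- WZ; auto).
apply (via K K'); auto.
apply (linked_trans mX mZ mK); auto; [rewrite E; auto |].
apply (linked_trans mZ base mK); auto using linked_sym.
Qed.

(** Images of good points are chosen by [image_spec]; bad points, such as the centre of a homothety,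
    stay fixed. *)
Lemma pencil_dilation :
  exists h, dilation h /\ h I = A /\ (forall X, ~ good X -> h X = X) /\
    (forall X, good X -> on (h X) (t X)).
Proof.
assert (total : forall X, exists X', (good X -> image_spec X X') /\ (~ good X -> X' = X)).
{ intros X; destruct (classic (good X)) as [g | b].
    destruct (image_exists g) as [X' H]; exists X'; tauto.
  exists X; tauto. }
set (h := fun X => proj1_sig (constructive_indefinite_description _ (total X))).
assert (hg : forall X, good X -> image_spec X (h X)).
{ intros X; apply (proj2_sig (constructive_indefinite_description _ (total X))). }
assert (hb : forall X, ~ good X -> h X = X).
{ intros X; apply (proj2_sig (constructive_indefinite_description _ (total X))). }
assert (ht : forall X, good X -> on (h X) (t X)).
{ intros X g; apply (hg X g). }
(* For [I] itself the clause on the base move is vacuous; [h I] and [A] are compared through a point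
   [Z] off the base line. *)
assert (hI : h I = A).
{ assert (gI := move_src base); destruct (hg I gI) as [mI [_ HI]].
  destruct good_off_base as [Z [gZ ZI]].
  destruct (image_exists_off gZ ZI) as [Z' [mZ [LZ _]]]; specialize (LZ ZI).
  apply (@linked_target_unique I (h I) A Z Z'); auto using linked_sym. }
exists h; repeat split; auto.
assert (images : forall X Y, good X -> good Y -> t Y <> t I -> t X <> t Y ->
  linked X (h X) Y (h Y)).
{ intros X Y gX gY YI XY.
  destruct (hg X gX) as [mX [_ HX]], (hg Y gY) as [mY [LY _]]; auto. }
intros X Y l Xl Yl.
destruct (classic (X = Y)) as [<- | XY]; [apply par_on |].
assert (same : forall Z, good Z -> on X (t Z) -> on Y (t Z) -> on (h Y) (par (h X) l)).
{ intros Z gZ X1 Y1; rewrite (@line_eq _ X Y l (t Z)); auto.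
  assert (stay : forall W, on W (t Z) -> on (h W) (t Z)).
  { intros W H; destruct (classic (good W)) as [g | b]; [| now rewrite hb].
    rewrite <- (@t_eq Z W); auto. }
  rewrite par_same; auto. }
(* If just one point is bad, it lies on the pencil line of the other, and [same] applies. *)
destruct (classic (good X)) as [gX | bX]; destruct (classic (good Y)) as [gY | bY]; eauto.
2: { rewrite !hb, par_same; auto. }
destruct (classic (t X = t Y)) as [E | N].
  apply (same X); auto; rewrite E; auto.
assert (P : parallel (join X Y) (join (h X) (h Y))).
(* If [Y] is on the base line then [X] is not, and the roles are exchanged. *)
{ destruct (classic (t Y = t I)) as [YI | YI]; [| apply images; auto].
  assert (XI : t X <> t I) by (rewrite <- YI; auto).
  apply linked_sym; [apply (hg Y gY) | apply (hg X gX) | apply images; auto]. }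
assert (N' := move_tgt_ne (proj1 (hg X gX)) (proj1 (hg Y gY)) N).
rewrite (@par_eq _ (h X) l (join (h X) (h Y))); auto using join_l, join_r.
rewrite <- (@join_eq _ X Y l); auto using parallel_sym.
Qed.

End Base.
End Pencil.

(** * Existence of translations and homotheties *)

Section Existence.
Variable pi : DesarguesPlane.
Implicit Types (O P Q X Y Z : point pi) (d : line pi).

Lemma translation_exists P Q d :
  on Q (par P d) -> exists f, dilation f /\ along d f /\ f P = Q.
Proof.
intros H; destruct (classic (P = Q)) as [<- | PQ].
  exists (fun X => X); auto using dilation_id, along_id.
destruct (@pencil_dilation pi (fun _ => True) (fun X => par X d)) with (I := P) (A := Q)
  as [h [Hh [hP [_ ht]]]]; auto using par_on, par_move.
- contradiction.
- left; intros X Y _ _; apply parallel_trans with d;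
    [| apply parallel_sym]; apply par_parallel.
- split; auto.
- exists h; repeat split; auto; intros X; apply ht; trivial.
Qed.

Lemma homothety_exists O P Q :
  O <> P -> on Q (join O P) -> exists h, dilation h /\ h O = O /\ h P = Q.
Proof.
intros OP HQ; destruct (classic (P = Q)) as [<- | PQ].
  exists (fun X => X); auto using dilation_id.
(* Sending [P] to [O] is not a move between good points; the constant map does it. *)
destruct (classic (O = Q)) as [<- | OQ].
  exists (fun _ => O); auto using dilation_const.
destruct (@pencil_dilation pi (fun X => O <> X) (join O)) with (I := P) (A := Q)
  as [h [Hh [hP [hb _]]]].
- auto using join_r.
- intros X Y HX HY H; apply join_eq; auto using join_l.
- intros X Y HX HY; rewrite <- (NNPP _ HX); auto using join_l.
- right; exists O; auto using join_l.
- split; auto.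
- exists h; repeat split; auto.
Qed.

End Existence.

(** * Arithmetic of the coordinate line *)

Section Coordinates.
Variables (pi : DesarguesPlane) (O I : point pi).
Hypothesis OI : O <> I.
Local Notation ell := (join O I).
Implicit Types (A B C S X Y : point pi).

Lemma shift_exists A : exists f, translation f /\ f O = A.
Proof.
destruct (classic (O = A)) as [<- | OA].
  exists (fun X => X); auto using translation_id.
destruct (@translation_exists pi O A (join O A)) as [f [Hf [df fO]]].
  rewrite par_same; auto using join_l, join_r.
exists f; split; [split; [exact Hf | exists (join O A); exact df] | exact fO].
Qed.

Lemma shift_along f A : translation f -> f O = A -> on A ell -> along ell f.
Proof.
intros Tf fO HA.
destruct (@translation_exists pi O A ell) as [g [Hg [dg gO]]].
  rewrite par_same; auto using join_l.
assert (Tg : translation g) by (split; [| exists ell]; auto).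
intros X; rewrite (translation_ext (P := O) Tf Tg); [apply dg | congruence].
Qed.

Lemma par_meet_eq P Q l m X Y :
  ~ parallel l m -> on X (par P l) -> on Y (par P l) -> on X (par Q m) ->
  on Y (par Q m) -> X = Y.
Proof.
intros N; apply meet_eq; intros E; apply N.
apply parallel_trans with (par P l); [apply parallel_sym, par_parallel |].
rewrite E; apply par_parallel.
Qed.

Lemma not_parallel_off P B1 :
  on P ell -> ~ on B1 ell -> ~ parallel (join P B1) ell.
Proof.
intros HP HB H; assert (N : P <> B1) by (intros E; apply HB; now rewrite <- E).
apply HB; rewrite <- (parallel_eq H (join_l N) HP); auto using join_r.
Qed.

Lemma not_parallel_joins B1 :
  ~ on B1 ell -> ~ parallel (join I B1) (join O B1).
Proof.
intros HB H.
assert (N : O <> B1) by (intros E; apply HB; rewrite <- E; auto using join_l).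
assert (M : I <> B1) by (intros E; apply HB; rewrite <- E; auto using join_r).
apply HB; rewrite (@join_eq _ O I (join O B1)); auto using join_l, join_r.
rewrite <- (parallel_eq H (join_r M) (join_r N)); auto using join_l.
Qed.

(** For every auxiliary [B1], the points [f B1] and [f B] meet the incidences required of [P1] and
    of the sum. Each is the meet of two non-parallel lines, so whatever [epsilon] selects equals
    [f B]. *)
Lemma add_shift f A B :
  translation f -> f O = A -> on A ell -> on B ell -> add O I A B = f B.
Proof.
intros Tf fO HA HB; assert (df := shift_along Tf fO HA); destruct Tf as [Hf _].
assert (construction : forall B1, ~ on B1 ell ->
  on (f B1) (par B1 ell) /\ on (f B1) (par A (join O B1)) /\
  on (f B) (par (f B1) (join B B1)) /\ on (f B) ell).
{ intros B1 H.
  assert (OB : O <> B1) by (intros E; apply H; rewrite <- E; auto using join_l).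
  assert (BB : B <> B1) by (intros E; apply H; now rewrite <- E).
  rewrite <- fO; repeat split; auto.
  - apply Hf; auto using join_l, join_r.
  - apply Hf; auto using join_l, join_r.
  - rewrite <- (par_same HB); auto. }
assert (S : is_sum O I A B (add O I A B)).
{ unfold add; apply epsilon_spec; destruct (point_off ell) as [B1 H].
  exists (f B), B1, (f B1); split; auto. }
destruct S as [B1 [P1 [H [H1 [H2 [H3 H4]]]]]].
destruct (construction B1 H) as [K1 [K2 [K3 K4]]].
assert (OB : on O ell) by auto using join_l.
assert (E : P1 = f B1) by
  exact (par_meet_eq (not_parallel_off OB H) H2 K2 H1 K1).
rewrite <- (par_same OB) in H4, K4; rewrite E in H3.
exact (par_meet_eq (not_parallel_off HB H) H3 K3 H4 K4).
Qed.

(** As for sums, [h] carries out the construction for every [B1]; [h B1] stays on [OB1] since [O] is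
    fixed. *)
Lemma mul_homothety h A B :
  dilation h -> h O = O -> h I = A -> on A ell -> on B ell -> mul O I A B = h B.
Proof.
intros Hh hO hI HA HB.
assert (construction : forall B1, ~ on B1 ell ->
  on (h B1) (par A (join I B1)) /\ on (h B1) (join O B1) /\
  on (h B) (par (h B1) (join B B1)) /\ on (h B) ell).
{ intros B1 H.
  assert (OB : O <> B1) by (intros E; apply H; rewrite <- E; auto using join_l).
  assert (IB : I <> B1) by (intros E; apply H; rewrite <- E; auto using join_r).
  assert (BB : B <> B1) by (intros E; apply H; now rewrite <- E).
  rewrite <- hI; repeat split.
  - apply Hh; auto using join_l, join_r.
  - rewrite <- (par_same (join_l OB)), <- hO at 1; apply Hh; auto using join_l, join_r.
  - apply Hh; auto using join_l, join_r.
  - rewrite <- (par_same (join_l OI)), <- hO at 1; apply Hh; auto using join_l. }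
assert (S : is_product O I A B (mul O I A B)).
{ unfold mul; apply epsilon_spec; destruct (point_off ell) as [B1 H].
  exists (h B), B1, (h B1); split; auto. }
destruct S as [B1 [P1 [H [H1 [H2 [H3 H4]]]]]].
destruct (construction B1 H) as [K1 [K2 [K3 K4]]].
assert (N : O <> B1) by (intros E; apply H; rewrite <- E; auto using join_l).
assert (OB : on O ell) by auto using join_l.
assert (E : P1 = h B1).
{ rewrite <- (par_same (join_l N)) in H2, K2.
  exact (par_meet_eq (not_parallel_joins H) H1 K1 H2 K2). }
rewrite <- (par_same OB) in H4, K4; rewrite E in H3.
exact (par_meet_eq (not_parallel_off HB H) H3 K3 H4 K4).
Qed.

Lemma homothety_on h X : dilation h -> h O = O -> on X ell -> on (h X) ell.
Proof.
intros Hh hO HX; rewrite <- (par_same (join_l OI)), <- hO at 1.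
apply Hh; auto using join_l.
Qed.

Lemma add_on A B : on A ell -> on B ell -> on (add O I A B) ell.
Proof.
intros HA HB; destruct (shift_exists A) as [f [Tf fO]].
rewrite (add_shift Tf fO); auto; rewrite <- (par_same HB).
exact (shift_along Tf fO HA B).
Qed.

Lemma mul_on A B : on A ell -> on B ell -> on (mul O I A B) ell.
Proof.
intros HA HB; destruct (homothety_exists OI HA) as [h [Hh [hO hI]]].
rewrite (mul_homothety Hh hO hI); auto using homothety_on.
Qed.

Lemma opp_on A : on A ell -> on (opp O I A) ell.
Proof.
intros HA; enough (E : exists S, on S ell /\ add O I A S = O /\ add O I S A = O)
  by apply (epsilon_spec (inhabits O) _ E).
assert (HO := join_l OI).
destruct (shift_exists A) as [f [Tf fO]].
destruct (@translation_exists pi A O ell) as [g [Hg [dg gA]]].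
  now rewrite par_same.
assert (Tg : translation g) by (split; [| exists ell]; auto).
assert (HS : on (g O) ell) by (rewrite <- (par_same HO); apply dg).
(* The translation [g] takes [A] to [O], so it undoes [f], and its value at [O] is the opposite. *)
exists (g O); repeat split; auto.
- rewrite (add_shift Tf fO); auto.
  apply (translation_fix (P := A) (translation_comp Tf Tg)); congruence.
- rewrite (add_shift Tg eq_refl); auto.
Qed.

Lemma inv_on A : on A ell -> on (inv O I A) ell.
Proof.
intros HA; assert (HO := join_l OI); assert (HI := join_r OI).
enough (E : exists S, on S ell /\ (A <> O -> mul O I A S = I /\ mul O I S A = I))
  by apply (epsilon_spec (inhabits O) _ E).
(* At [O] the inverse law is vacuous, so any point of the line will do. *)
destruct (classic (A = O)) as [E | AO]; [exists O; tauto |].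
destruct (homothety_exists OI HA) as [h [Hh [hO hI]]].
assert (OA : O <> A) by auto.
destruct (@homothety_exists pi O A I OA) as [g [Hg [gO gA]]].
  now rewrite (@join_eq _ O A ell).
exists (g I); split; [auto using homothety_on |]; intros _; split.
- rewrite (mul_homothety Hh hO hI); auto using homothety_on.
  (* [h] after [g] fixes both [O] and [A], hence is the identity. *)
  apply (dilation_ext (dilation_comp Hh Hg) (@dilation_id pi) OA); congruence.
- rewrite (mul_homothety Hg gO eq_refl); auto using homothety_on.
Qed.

(** Every operation in the cross-ratio keeps to the line, also where [inv] is taken at [O]; this
    reduces the theorem to distributivity on the line. *)
Lemma R4_D_on A B C U :
  on A ell -> on B ell -> on C ell -> R4_D O I A B C U -> on U ell.
Proof.
intros HA HB HC [X [HX ->]].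
unfold f_D, cross_ratio, sub; auto 10 using mul_on, inv_on, add_on, opp_on.
Qed.

Lemma mul_addr A B C :
  on A ell -> on B ell -> on C ell ->
  mul O I A (add O I B C) = add O I (mul O I A B) (mul O I A C).
Proof.
intros HA HB HC.
destruct (homothety_exists OI HA) as [h [Hh [hO hI]]].
destruct (shift_exists B) as [f [Tf fO]].
destruct (shift_exists (mul O I A B)) as [g [Tg gO]].
assert (mulE := fun X => @mul_homothety h A X Hh hO hI HA).
rewrite mulE, (add_shift Tf fO), (add_shift Tg gO), mulE; auto using mul_on, add_on.
assert (df := shift_along Tf fO HB).
assert (dg := shift_along Tg gO (mul_on HA HB)).
(* The claim is [h (f C) = g (h C)]. Both composites send [O] to the product of [A] and [B], and
   their values differ only along the line. *)
apply (dilation_ext_along (dilation_comp Hh (proj1 Tf)) (dilation_comp (proj1 Tg) Hh)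
         (P := O) (d := ell)).
  rewrite fO, hO, gO, mulE; auto.
intros X; apply par_trans with (h X); [| apply dg].
rewrite <- (par_par _ X); apply Hh; [apply df | apply par_on].
Qed.

(** Vector addition with origin [O] on the whole plane, needed to add homotheties at points off the
    line. *)
Definition shift_by A : point pi -> point pi :=
  proj1_sig (constructive_indefinite_description _ (shift_exists A)).

Lemma shift_by_spec A : translation (shift_by A) /\ shift_by A O = A.
Proof. exact (proj2_sig (constructive_indefinite_description _ (shift_exists A))). Qed.

(** Passing from [X] to [Y] along [l] changes each summand along the direction of [l]: first [g X]
    to [g Y], then the shift by [f X] to that by [f Y]. *)
Lemma dilation_sum f g :
  dilation f -> dilation g -> dilation (fun X => shift_by (f X) (g X)).
Proof.
intros Hf Hg X Y l Xl Yl.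
destruct (shift_by_spec (f X)) as [TX EX], (shift_by_spec (f Y)) as [TY EY].
destruct (@translation_exists pi (f X) (f Y) l (Hf X Y l Xl Yl)) as [m [Hm [dm mX]]].
assert (Tm : translation m) by (split; [| exists l]; auto).
(* The shift by [f Y] is the shift by [f X] followed by [m], as both take [O] to [f Y]. *)
rewrite (translation_ext (P := O) TY (translation_comp Tm TX)) by congruence.
apply par_trans with (shift_by (f X) (g Y)); [| apply dm].
rewrite <- (par_par _ (g X)); apply (proj1 TX); [apply par_on | apply Hg; auto].
Qed.

Lemma mul_addl A B C :
  on A ell -> on B ell -> on C ell ->
  mul O I (add O I A B) C = add O I (mul O I A C) (mul O I B C).
Proof.
intros HA HB HC.
destruct (homothety_exists OI HA) as [f [Hf [fO fI]]].
destruct (homothety_exists OI HB) as [g [Hg [gO gI]]].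
assert (Hs := dilation_sum Hf Hg).
assert (addE : forall X, on X ell ->
  add O I (f X) (g X) = shift_by (f X) (g X)).
{ intros X HX; destruct (shift_by_spec (f X)) as [T E].
  apply add_shift; auto using homothety_on. }
(* The pointwise sum fixes [O] and takes [I] to the sum of [A] and [B], so it computes left
   multiplication by that sum. *)
rewrite (mul_homothety Hs); auto using add_on.
- rewrite (mul_homothety Hf fO fI), (mul_homothety Hg gO gI), addE; auto.
- rewrite fO, gO; apply shift_by_spec.
- rewrite <- addE, fI, gI; auto using join_r.
Qed.

End Coordinates.

Theorem theorem12 (pi : DesarguesPlane) (O I : point pi) (hOI : O <> I)
    (A B C : point pi)
    (hA : on A (join O I)) (hB : on B (join O I)) (hC : on C (join O I))
    (U V W : point pi)
    (hU : R4_D O I A B C U) (hV : R4_D O I A B C V) (hW : R4_D O I A B C W) :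
  mul O I U (add O I V W) = add O I (mul O I U V) (mul O I U W) /\
  mul O I (add O I U V) W = add O I (mul O I U W) (mul O I V W).
Proof.
assert (oU := R4_D_on hOI hA hB hC hU).
assert (oV := R4_D_on hOI hA hB hC hV).
assert (oW := R4_D_on hOI hA hB hC hW).
split; [now apply mul_addr | now apply mul_addl].
Qed.
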